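(* Let $\mathcal F=(X,F)$, $\mathcal G=(Y,G)$, $\mathcal H=(Z,H)$ be Bishop spaces. For $\lambda\in\mathrm{Mor}(\mathcal G,\mathcal H)$ let $\lambda^+:\mathrm{Mor}(\mathcal H,\mathcal F)\to\mathrm{Mor}(\mathcal G,\mathcal F)$, $\lambda^+(\phi):=\phi\circ\lambda$, and for $\mu\in\mathrm{Mor}(\mathcal H,\mathcal G)$ let $\mu^-:\mathrm{Mor}(\mathcal F,\mathcal H)\to\mathrm{Mor}(\mathcal F,\mathcal G)$, $\mu^-(\theta):=\mu\circ\theta$. Let ${}^+:\mathrm{Mor}(\mathcal G,\mathcal H)\to\mathrm{Mor}(\mathcal H\to\mathcal F,\mathcal G\to\mathcal F)$ be $\lambda\mapsto\lambda^+$ and ${}^-:\mathrm{Mor}(\mathcal H,\mathcal G)\to\mathrm{Mor}(\mathcal F\to\mathcal H,\mathcal F\to\mathcal G)$ be $\mu\mapsto\mu^-$. Then ${}^+\in\mathrm{Mor}(\mathcal G\to\mathcal H,(\mathcal H\to\mathcal F)\to(\mathcal G\to\mathcal F))$ and ${}^-\in\mathrm{Mor}(\mathcal H\to\mathcal G,(\mathcal F\to\mathcal H)\to(\mathcal F\to\mathcal G))$.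
   Context: Work in Bishop-style constructive mathematics. A Bishop topology on a set $X$ is a set $F$ of functions $X\to\mathbb R$ containing the constant functions, closed under addition, under composition with functions $\mathbb R\to\mathbb R$ uniformly continuous on every $[-n,n]$, and under uniform limits; $(X,F)$ is a Bishop space. For a set $F_0$ of functions $X\to\mathbb R$, $\bigvee F_0$ is the least Bishop topology containing $F_0$. A Bishop morphism $(X,F)\to(Y,G)$ is a function $h:X\to Y$ with $g\circ h\in F$ for all $g\in G$; $\mathrm{Mor}(\mathcal F,\mathcal G)$ is their set (equality pointwise). The (pointwise) exponential Bishop space is $\mathcal F\to\mathcal G=(\mathrm{Mor}(\mathcal F,\mathcal G),F\to G)$ where $F\to G=\bigvee\{\phi_{x,g}:x\in X,g\in G\}$ and $\phi_{x,g}(h)=g(h(x))$. *)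

(* Defs.v *)
From Stdlib Require Import Reals.
Open Scope R_scope.


Definition Bcont (phi : R -> R) : Prop :=
  forall (n : nat) (eps : R), 0 < eps ->
    exists delta, 0 < delta /\
      forall x y, - INR n <= x <= INR n -> - INR n <= y <= INR n ->
        Rabs (x - y) < delta -> Rabs (phi x - phi y) < eps.

Record is_bishop {X : Type} (F : (X -> R) -> Prop) : Prop := {
  bt_const : forall c : R, F (fun _ => c);
  bt_add : forall f g, F f -> F g -> F (fun x => f x + g x);
  bt_comp : forall f phi, F f -> Bcont phi -> F (fun x => phi (f x));
  bt_lim : forall f : X -> R,
      (forall eps, 0 < eps -> exists g, F g /\ forall x, Rabs (g x - f x) <= eps) ->
      F f }.

Arguments bt_const {X F}.
Arguments bt_add {X F}.
Arguments bt_comp {X F}.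
Arguments bt_lim {X F}.

Definition bigvee {X : Type} (F0 : (X -> R) -> Prop) : (X -> R) -> Prop :=
  fun f => forall T : (X -> R) -> Prop, is_bishop T -> (forall g, F0 g -> T g) -> T f.

Lemma bigvee_bishop {X : Type} (F0 : (X -> R) -> Prop) : is_bishop (bigvee F0).
Proof.
  split.
  - intros c T HT _; apply (bt_const HT).
  - intros f g Hf Hg T HT H0; apply (bt_add HT); [apply Hf|apply Hg]; assumption.
  - intros f phi Hf Hphi T HT H0; apply (bt_comp HT); [apply Hf|]; assumption.
  - intros f Hf T HT H0; apply (bt_lim HT); intros eps Heps.
    destruct (Hf eps Heps) as [g [Hg Hgf]]; exists g; split; [apply Hg|]; assumption.
Qed.

Lemma bigvee_incl {X : Type} (F0 : (X -> R) -> Prop) g : F0 g -> bigvee F0 g.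
Proof. intros Hg T _ H0; apply H0; exact Hg. Qed.

Record BSpace := {
  carrier :> Type;
  topo : (carrier -> R) -> Prop;
  topo_bishop : is_bishop topo }.
Arguments topo : clear implicits.
Arguments topo_bishop : clear implicits.

Definition is_mor (A B : BSpace) (h : A -> B) : Prop :=
  forall g, topo B g -> topo A (fun x => g (h x)).

Definition Mor (A B : BSpace) : Type := { h : A -> B | is_mor A B h }.

Definition mor_fun {A B : BSpace} (h : Mor A B) : A -> B := proj1_sig h.
Coercion mor_fun : Mor >-> Funclass.

Definition exp_gen (A B : BSpace) : (Mor A B -> R) -> Prop :=
  fun Phi => exists (x : A) (g : B -> R), topo B g /\ Phi = (fun h : Mor A B => g (mor_fun h x)).

Definition exp_topo (A B : BSpace) : (Mor A B -> R) -> Prop := bigvee (exp_gen A B).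

Definition expB (A B : BSpace) : BSpace :=
  {| carrier := Mor A B; topo := exp_topo A B; topo_bishop := bigvee_bishop _ |}.

Lemma mor_into_bigvee (A : BSpace) (B : Type) (F0 : (B -> R) -> Prop) (h : A -> B) :
  (forall g, F0 g -> topo A (fun x => g (h x))) ->
  forall g, bigvee F0 g -> topo A (fun x => g (h x)).
Proof.
  intros H0 g Hg.
  apply (Hg (fun g => topo A (fun x => g (h x)))); [|exact H0].
  pose proof (topo_bishop A) as HA.
  split.
  - intros c; apply (bt_const HA).
  - intros f1 f2 H1 H2; apply (bt_add HA _ _ H1 H2).
  - intros f phi Hf Hp; apply (bt_comp HA _ _ Hf Hp).
  - intros f Hf; apply (bt_lim HA); intros eps Heps.
    destruct (Hf eps Heps) as [g' [Hg' Hgf]].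
    exists (fun x => g' (h x)); split; [exact Hg'|intros x; apply Hgf].
Qed.

Section Plus.
Variables (F G H : BSpace) (lam : Mor G H).

Definition plus_comp (phi : Mor H F) : Mor G F.
Proof.
  exists (fun y => phi (lam y)).
  intros f Hf. exact (proj2_sig lam _ (proj2_sig phi f Hf)).
Defined.

Lemma plus_comp_mor : is_mor (expB H F) (expB G F) plus_comp.
Proof.
  unfold is_mor; apply mor_into_bigvee.
  intros Phi [y [g [Hg ->]]]. simpl.
  apply bigvee_incl. exists (lam y), g. split; [exact Hg|reflexivity].
Qed.

Definition lplus : Mor (expB H F) (expB G F) := exist _ plus_comp plus_comp_mor.
End Plus.

Section Minus.
Variables (F G H : BSpace) (mu : Mor H G).

Definition minus_comp (theta : Mor F H) : Mor F G.
Proof.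
  exists (fun x => mu (theta x)).
  intros g Hg. exact (proj2_sig theta _ (proj2_sig mu g Hg)).
Defined.

Lemma minus_comp_mor : is_mor (expB F H) (expB F G) minus_comp.
Proof.
  unfold is_mor; apply mor_into_bigvee.
  intros Phi [x [g [Hg ->]]]. simpl.
  apply bigvee_incl. exists x, (fun z => g (mu z)).
  split; [exact (proj2_sig mu g Hg)|reflexivity].
Qed.

Definition lminus : Mor (expB F H) (expB F G) := exist _ minus_comp minus_comp_mor.
End Minus.

(* Main.v *)
(* The exponential topology is generated by the evaluations followed by functions of
   the target topology, so a map into an exponential space is a morphism as soon as
   each of its evaluations is.  Applying this twice reduces both claims to evaluation
   maps: [lam |-> lam^+ phi y] is [phi] after evaluation at [y], and
   [mu |-> mu^- theta x] is evaluation at [theta x]. *)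
Require Import Defs.

Lemma is_mor_comp (A B C : BSpace) (f : A -> B) (g : B -> C) :
  is_mor A B f -> is_mor B C g -> is_mor A C (fun a => g (f a)).
Proof. intros Hf Hg k Hk; exact (Hf _ (Hg k Hk)). Qed.

Lemma is_mor_eval (A B : BSpace) (a : A) :
  is_mor (expB A B) B (fun h : Mor A B => h a).
Proof. intros g Hg; apply bigvee_incl; exists a, g; split; [exact Hg | reflexivity]. Qed.

Lemma is_mor_into_expB (A B C : BSpace) (h : A -> Mor B C) :
  (forall b : B, is_mor A C (fun a => h a b)) -> is_mor A (expB B C) h.
Proof.
  intros Heval; unfold is_mor; apply mor_into_bigvee.
  intros Phi [b [g [Hg ->]]]; exact (Heval b g Hg).
Qed.

Theorem proposition11p1 (F G H : BSpace) :
  is_mor (expB G H) (expB (expB H F) (expB G F)) (fun lam : Mor G H => lplus F G H lam)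
  /\ is_mor (expB H G) (expB (expB F H) (expB F G)) (fun mu : Mor H G => lminus F G H mu).
Proof.
  split.
  - apply is_mor_into_expB; intros phi; apply is_mor_into_expB; intros y.
    exact (is_mor_comp _ _ _ _ _ (is_mor_eval G H y) (proj2_sig phi)).
  - apply is_mor_into_expB; intros theta; apply is_mor_into_expB; intros x.
    exact (is_mor_eval H G ((theta : Mor F H) x)).
Qed.
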